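(* Let $G$ be a (4,6)-fullerene graph and $C$ a 6-cycle in $G$. Then $C$ is the boundary of a hexagonal face, a dual-square, a square-cap, or the boundary of a square-cap with $k$ hexagon-layers for some $k\geqslant 1$.
   Context: A (4,6)-fullerene graph is a plane 3-regular graph all of whose faces are bounded by 4-cycles (square faces) or 6-cycles (hexagonal faces), with exactly six square faces. A 6-cycle $C=u_1\cdots u_6u_1$ of $G$ is a dual-square if $G$ has an edge joining two opposite vertices of $C$ (e.g. $u_2u_5$); $C$ is a square-cap if $G$ has a vertex $w\notin V(C)$ adjacent to three pairwise nonconsecutive vertices of $C$ (e.g. $u_1,u_3,u_5$). For $k\geqslant 1$, a square-cap with $k$ hexagon-layers is the plane graph $S_k$ with vertices $a$ and $c_{i,j}$ ($0\leqslant i\leqslant k$, $1\leqslant j\leqslant 6$), the 6-cycles $c_{i,1}\cdots c_{i,6}c_{i,1}$, edges $ac_{0,j}$ for odd $j$, and edges $c_{i,j}c_{i+1,j}$ for $0\leqslant i<k$ and $j\equiv i\pmod 2$ (a cap of three squares surrounded by $k$ concentric layers of three hexagons); its outer boundary is the 6-cycle $c_{k,1}\cdots c_{k,6}c_{k,1}$. $C$ is the boundary of a square-cap with $k$ hexagon-layers if $G$ contains a subgraph isomorphic to $S_k$ in which $C$ corresponds to this outer 6-cycle. *)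

(* Defs.v *)
From mathcomp Require Import all_boot fingroup perm.

Set Implicit Arguments.
Unset Strict Implicit.
Unset Printing Implicit Defensive.

Section Embedding.

Variables (V : finType) (adj : rel V) (rotation : V -> {perm V}).

Definition arcs : {set V * V} := [set a | adj a.1 a.2].

Definition edges : {set {set V}} := [set [set a.1; a.2] | a in arcs].

(* A rotation system lists the neighbours of each vertex v in their cyclic   *)
(* order around v. Values of [rotation v] off that neighbourhood play no     *)
(* role.                                                                     *)
Definition rotation_system : Prop :=
  forall v x, adj v x -> porbit (rotation v) x = [set y | adj v y].

(* Having walked along u -> v, a face walk leaves v by the edge that follows *)
(* vu in the rotation at v. Faces are the orbits of arcs under this map.     *)
Definition face_next (a : V * V) : V * V := (a.2, rotation a.2 a.1).

Definition face_of (a : V * V) : {set V * V} := [set b in orbit face_next a].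

Definition faces : {set {set V * V}} := [set face_of a | a in arcs].

Definition face_walk (a : V * V) : seq V := [seq b.1 | b <- orbit face_next a].

End Embedding.

(* A connected plane graph with at least one edge, as a rotation system of   *)
(* genus 0 on a simple graph; the unbounded face is among the faces.         *)
Record plane_graph := PlaneGraph {
  vertex :> finType;
  adj : rel vertex;
  rotation : vertex -> {perm vertex};
  adj_sym : symmetric adj;
  adj_irr : irreflexive adj;
  rotationP : rotation_system adj rotation;
  has_edge : arcs adj != set0;
  connected : forall x y, connect adj x y;
  euler : #|vertex| + #|faces adj rotation| = #|edges adj| + 2
}.

(* For a cycle given as a sequence of vertices, its set of edges: this       *)
(* identifies the cycle as a subgraph, forgetting start and direction.       *)
Definition cycle_edges (V : finType) (C : seq V) : {set {set V}} :=
  [set [set x; next C x] | x in C].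

Definition is_cycle (G : plane_graph) (n : nat) (C : seq G) : Prop :=
  ucycle (@adj G) C /\ size C = n.

(* Connectedness, part of [plane_graph], is no extra hypothesis here: a      *)
(* plane graph all of whose faces are bounded by cycles is connected.        *)
Definition fullerene46 (G : plane_graph) : Prop :=
  [/\ forall v : G, #|[set w | adj v w]| = 3,
      forall a, a \in arcs (@adj G) ->
        is_cycle 4 (face_walk (@rotation G) a) \/
        is_cycle 6 (face_walk (@rotation G) a)
    & #|[set F in faces (@adj G) (@rotation G) | #|F| == 4]| = 6].

Section SixCycles.

Variables (G : plane_graph) (C : seq G).

Definition hexagonal_face_boundary : Prop :=
  exists2 a, a \in arcs (@adj G) &
    is_cycle 6 (face_walk (@rotation G) a) /\
    cycle_edges (face_walk (@rotation G) a) = cycle_edges C.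

Definition dual_square : Prop :=
  exists2 x, x \in C & adj x (iter 3 (next C) x).

Definition nonconsecutive (x y : G) : bool :=
  [&& x != y, y != next C x & x != next C y].

Definition square_cap : Prop :=
  exists2 w : G, w \notin C &
  exists x y z, [/\ [/\ x \in C, y \in C & z \in C],
                    [/\ nonconsecutive x y, nonconsecutive y z
                      & nonconsecutive x z]
                  & [/\ adj w x, adj w y & adj w z]].

End SixCycles.

(* The graph S_k: None is the apex a, and Some (i, j) is c_{i,j}, where      *)
(* j : 'I_6 is read modulo 6, i.e., j = 0 stands for the index 6.            *)
Definition cap_vertex (k : nat) : finType := option ('I_k.+1 * 'I_6).

Definition cap_arc (k : nat) (x y : cap_vertex k) : bool :=
  match x, y with
  | None, Some (i, j) => (val i == 0) && odd j
  | Some (i, j), Some (i', j') =>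
         (i' == i) && (j' == ordS j)
      || [&& val i' == i.+1, j' == j & j == i %[mod 2]]
  | _, None => false
  end.

Definition cap_adj (k : nat) : rel (cap_vertex k) :=
  fun x y => cap_arc x y || cap_arc y x.

Definition cap_outer (k : nat) : seq (cap_vertex k) :=
  [seq Some (ord_max, j) | j <- enum 'I_6].

Definition layered_square_cap_boundary (G : plane_graph) (k : nat) (C : seq G)
    : Prop :=
  exists f : cap_vertex k -> G,
    [/\ injective f,
        forall x y, cap_adj x y -> adj (f x) (f y)
      & cycle_edges [seq f x | x <- cap_outer k] = cycle_edges C].

(* Main.v *)
Require Import Defs.
From mathcomp Require Import all_boot fingroup perm.

Set Implicit Arguments.
Unset Strict Implicit.
Unset Printing Implicit Defensive.

(** The proof is local and does not use the Jordan curve theorem. Each vertex of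
    the 6-cycle C sends its third edge to the left or to the right of C;
    reversing C if needed, at most three edges go left. The faces on the left of
    C have length 4 or 6, which leaves few cases for the cyclic gaps between the
    left edges: none (C is a face), (3,3) (a dual-square), and
    (2,2,2), (3,2,1), (3,1,2), (4,1,1). In the last three cases all faces met
    are hexagons and one finds another ring of the same shape (a 4-cycle for
    (4,1,1)) further to the left, and so on forever. By finiteness some of these
    rings follow each other cyclically; they form a hexagonal torus, which by
    connectedness is the whole graph, but G has squares. In case (2,2,2) there
    is either a cap of three squares, or three hexagons and again a ring of type
    (2,2,2); for the same reason the cap is eventually reached. The layers
    found on the way are disjoint because, going outward from the cap, the only
    vertices with neighbours outside are the three outward ones of the last
    ring. *)

(** * Cubic maps with faces of length 4 and 6, in terms of corners *)

Section Turns.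

(* [T a b c] means that c follows a in the rotation at b, so that a face walk
   arriving at b from a continues to c. For a path a, b, c, the third edge at b
   goes to the left when [T c b a] and to the right when [T a b c]. *)

Variables (V : finType) (adj : rel V) (T : V -> V -> V -> bool).

Definition quad a b c d :=
  [&& T a b c, T b c d, T c d a, T d a b & uniq [:: a; b; c; d]].

Definition hexa a b c d e f :=
  [&& T a b c, T b c d, T c d e, T d e f, T e f a, T f a b
    & uniq [:: a; b; c; d; e; f]].

(* A cubic map with faces of length 4 and 6, at least one of them a square,
   axiomatised so that the mirror image is again an instance. *)
Record cubic46 : Prop := Cubic46 {
  c46_sym : symmetric adj;
  c46_irr : irreflexive adj;
  c46_conn : forall x y, connect adj x y;
  c46_adjl : forall a b c, T a b c -> adj b a;
  c46_adjr : forall a b c, T a b c -> adj b c;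
  c46_turn : forall a b, adj b a -> exists c, T a b c;
  c46_fun : forall a b c c', T a b c -> T a b c' -> c = c';
  c46_third : forall a b c, T a b c -> exists d,
    [/\ T c b d, T d b a, uniq [:: a; c; d]
      & forall x, adj b x -> x \in [:: a; c; d]];
  c46_face : forall a b c, T a b c ->
    (exists d, quad a b c d) \/ (exists d e f, hexa a b c d e f);
  c46_quad : exists a b c d, quad a b c d
}.

End Turns.

(** The inverse of a cyclic order on three neighbours is again one, and faces are read backwards.
    Exchanging left and right in this way makes [T] injective in its first argument and reduces the
    gaps (3,1,2) to (3,2,1). *)
Lemma cubic46_mirror (V : finType) (adj : rel V) (T : V -> V -> V -> bool) :
  cubic46 adj T -> cubic46 adj (fun a b c => T c b a).
Proof.
case=> sym irr conn adjl adjr turn func third face [a0 [b0 [c0 [d0 Q0]]]].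
have quadV a b c d : quad T c b a d -> quad (fun a b c => T c b a) a b c d.
  case/and5P=> h1 h2 h3 h4 u; apply/and5P; split=> //.
  by move: u; rewrite /= !inE ![_ == a]eq_sym ![_ == b]eq_sym ![_ == c]eq_sym
    ![_ == d]eq_sym; do ![case: eqP => //= _].
have hexaV a b c d e f :
    hexa T c b a f e d -> hexa (fun a b c => T c b a) a b c d e f.
  do 6![case/andP=> ?]; move=> u; do 6![apply/andP; split=> //].
  have -> : [:: a; b; c; d; e; f] = rot 3 (rev [:: c; b; a; f; e; d]) by [].
  by rewrite rot_uniq rev_uniq.
split=> //.
- by move=> a b c /adjr.
- by move=> a b c /adjl.
- move=> a b /turn[c abc]; have [d [_ dba _ _]] := third _ _ _ abc.
  by exists d.
- move=> a b c c' ca c'a.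
  have [d [ad dc _ _]] := third _ _ _ ca.
  have [d' [ad' d'c' _ _]] := third _ _ _ c'a.
  by move: d'c'; rewrite -(func _ _ _ _ ad ad') => /(func _ _ _ _ dc).
- move=> a b c ca; have [d [ad dc u N]] := third _ _ _ ca.
  exists d; split=> //; last by move=> x /N; rewrite !inE orbCA.
  by move: u; rewrite /= !inE ![_ == a]eq_sym; do ![case: eqP => //= _].
- move=> a b c /face[[d Q]|[d [e [f H]]]]; [left|right].
    by exists d; apply: quadV.
  by exists f, e, d; apply: hexaV.
- by exists c0, b0, a0, d0; apply: quadV.
Qed.

(** * Corners at a vertex and faces along a ring *)

Section Local.

Variables (V : finType) (adj : rel V) (T : V -> V -> V -> bool).
Hypothesis M : cubic46 adj T.

Lemma turn_funl a a' b c : T a b c -> T a' b c -> a = a'.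
Proof. by apply: (c46_fun (cubic46_mirror M)). Qed.

Lemma turn_neq a b : T a b a = false.
Proof.
by apply/negP=> /(c46_third M)[d []]; rewrite /= !inE eqxx.
Qed.

Lemma turn_asym a b c : T a b c -> T c b a -> False.
Proof.
case/(c46_third M)=> d [cbd _ u _] /(c46_fun M cbd) E.
by move: u; rewrite E /= !inE eqxx orbT.
Qed.

Lemma turn_close a b c d : T a b c -> T c b d -> T d b a.
Proof. by case/(c46_third M)=> e [cbe eba _ _] /(c46_fun M cbe) <-. Qed.

(** Supplies the left edge b - t of a path a, b, c, with the corners on both sides of it. *)
Lemma turn_third a b c : T c b a -> exists t, T a b t /\ T t b c.
Proof. by case/(c46_third M)=> t [? ? _ _]; exists t. Qed.

Lemma turn_nbrs a b c d x :
  T a b c -> T c b d -> adj b x -> x \in [:: a; c; d].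
Proof.
by case/(c46_third M)=> e [cbe _ _ N] /(c46_fun M cbe) <-; apply: N.
Qed.

Lemma turn_or a b c : adj b a -> adj b c -> a != c -> T a b c \/ T c b a.
Proof.
move=> /(c46_turn M)[d abd] bc ac; have [e [dbe eba _ N]] := c46_third M abd.
move: (N _ bc); rewrite !inE eq_sym (negPf ac) /=.
by case/orP=> /eqP->; [left|right].
Qed.

Lemma hexaE a b c d e f : hexa T a b c d e f ->
  [/\ [/\ T a b c, T b c d & T c d e], [/\ T d e f, T e f a & T f a b]
    & uniq [:: a; b; c; d; e; f]].
Proof. by do 6![case/andP=> ?]. Qed.

Lemma quadE a b c d : quad T a b c d ->
  [/\ T a b c, T b c d, T c d a, T d a b & uniq [:: a; b; c; d]].
Proof. by case/and5P. Qed.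

Ltac unpack := repeat match goal with
  | H : is_true (hexa _ _ _ _ _ _ _) |- _ =>
      destruct (hexaE H) as [[? ? ?] [? ? ?] ?]; clear H
  | H : is_true (quad _ _ _ _ _) |- _ =>
      destruct (quadE H) as [? ? ? ? ?]; clear H
  end.

(** [T] is a partial function in its first and in its last argument, so two corners that agree in
    two consecutive places coincide. Repeating this glues overlapping faces together. *)
Ltac saturate := repeat match goal with
  | H : is_true (T ?a ?b ?c), H' : is_true (T ?a ?b ?d) |- _ =>
     first [constr_eq c d; clear H'
           | pose proof (c46_fun M H H'); first [subst d | subst c]]
  | H : is_true (T ?a ?b ?c), H' : is_true (T ?d ?b ?c) |- _ =>
     first [constr_eq a d; clear H'
           | pose proof (turn_funl H H'); first [subst d | subst a]]
  end.

Ltac absurd_turn := exfalso; match goal with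
  | H : is_true (T ?a _ ?a) |- _ => by rewrite turn_neq in H
  | H : is_true (T ?a ?b ?c), H' : is_true (T ?c ?b ?a) |- _ =>
     exact: turn_asym H H'
  | H : is_true (uniq _) |- _ =>
     solve [move: H; rewrite /= !inE ?eqxx ?orbT ?andbF //=]
  end.

Ltac clash := unpack; saturate; absurd_turn.

(* Face walks running along a ring c0, c1, ... between two consecutive left
   edges c0 - t0 and cn - tn. *)
Lemma gap1 t0 c0 c1 t1 : T t0 c0 c1 -> T c0 c1 t1 ->
  quad T t0 c0 c1 t1 \/ exists v v', hexa T t0 c0 c1 t1 v v'.
Proof.
move=> h0 h1; case: (c46_face M h0) => [[d Q]|[d [e [f H]]]]; [left|right].
  by case/quadE: (Q)=> _ /(c46_fun M h1) ->.
by exists e, f; case/hexaE: (H)=> [[_ /(c46_fun M h1) -> _]].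
Qed.

Lemma gap2 t0 c0 c1 c2 t2 : T t0 c0 c1 -> T c0 c1 c2 -> T c1 c2 t2 ->
  (t2 = t0 /\ quad T t0 c0 c1 c2) \/ exists v, hexa T t0 c0 c1 c2 t2 v.
Proof.
move=> h0 h1 h2; case: (gap1 h0 h1) => [Q|[v [v' H]]]; [left|right].
  by split=> //; case/quadE: Q => _ _ /(c46_fun M h2).
by exists v'; case/hexaE: (H)=> [[_ _ /(c46_fun M h2) ->]].
Qed.

(** A square runs through t0, c0, c1, c2 and back to t0, so c3 is t0 and both left edges are the
    chord c0 - c3. *)
Lemma gap3 t0 c0 c1 c2 c3 t3 :
  T t0 c0 c1 -> T c0 c1 c2 -> T c1 c2 c3 -> T c2 c3 t3 ->
  [/\ t0 = c3, t3 = c0 & quad T t0 c0 c1 c2] \/ hexa T t0 c0 c1 c2 c3 t3.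
Proof.
move=> h0 h1 h2 h3; case: (gap2 h0 h1 h2) => [[E Q]|[v H]]; [left|right].
  by split=> //; unpack; saturate.
by case/hexaE: (H) => _ [/(c46_fun M h3) ->].
Qed.

(** The walk from t0 to t4 lists seven vertices, so a hexagon closes up with t4 = t0; a square would
    give c4 = c0. *)
Lemma gap4 t0 c0 c1 c2 c3 c4 t4 : c0 != c4 ->
  T t0 c0 c1 -> T c0 c1 c2 -> T c1 c2 c3 -> T c2 c3 c4 -> T c3 c4 t4 ->
  t4 = t0 /\ hexa T t0 c0 c1 c2 c3 c4.
Proof.
move=> ne h0 h1 h2 h3 h4; case: (gap3 h0 h1 h2 h3) => [[_ E]|H].
  by rewrite E eqxx in ne.
by split=> //; case/hexaE: H => _ [_ /(c46_fun M h4)].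
Qed.

(** * Short closed walks *)

(** On one of the two sides at most one third edge leaves the triangle. The face on that side would
    be the triangle itself, or would come back too early to the vertex with that edge. *)
Lemma no_triangle x y z : adj x y -> adj y z -> adj z x -> False.
Proof.
have cyc a b c : T a b c -> T b c a -> T c a b -> False.
  by move=> h1 h2 h3; case: (c46_face M h1) => [[d Q]|[d [e [f H]]]]; clash.
have one a b c : T b a c -> T a b c -> T b c a -> False.
  case/turn_third=> t [h1 h2] h3 h4.
  by case: (gap2 h2 h3 h4) => [[E Q]|[v H]]; clash.
move=> xy yz zx; have sym := c46_sym M.
have neq a b : adj a b -> a != b.
  by apply: contraTneq => ->; rewrite (c46_irr M).
have [hx|hx] : T z x y \/ T y x z by apply: turn_or; rewrite 1?sym ?neq // sym.
all: have [hy|hy] : T x y z \/ T z y x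
  by apply: turn_or; rewrite 1?sym ?neq // sym.
all: have [hz|hz] : T y z x \/ T x z y
  by apply: turn_or; rewrite 1?sym ?neq // sym.
all: solve [exact: (cyc x y z) | exact: (cyc z y x) | exact: (one x y z)
 | exact: (one y z x) | exact: (one z x y) | exact: (one z y x)
 | exact: (one y x z) | exact: (one x z y)].
Qed.

(** Vertices at distance 1 along the walk differ by irreflexivity, at distance 2 by assumption, and
    at distance 3 because equality would close a triangle. *)
Lemma closed_walk6_uniq d0 d1 d2 d3 d4 d5 :
  [&& adj d0 d1, adj d1 d2, adj d2 d3, adj d3 d4, adj d4 d5 & adj d5 d0] ->
  [&& d0 != d2, d1 != d3, d2 != d4, d3 != d5, d4 != d0 & d5 != d1] ->
  uniq [:: d0; d1; d2; d3; d4; d5].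
Proof.
do 5![case/andP=> ?]; move=> ?; do 5![case/andP=> ?]; move=> ?.
have neq a b : adj a b -> a != b.
  by apply: contraTneq => ->; rewrite (c46_irr M).
have opp a b c d : adj a b -> adj b c -> adj c d -> a != d.
  move=> ab bc cd; apply/eqP=> E; rewrite -E in cd.
  exact: no_triangle ab bc cd.
rewrite /= !inE !negb_or; do ![apply/andP; split] => //.
all: solve [exact: neq | by rewrite eq_sym neq | by rewrite eq_sym
  | by apply: opp; eassumption].
Qed.

Lemma hexa_rot a b c d e f : hexa T a b c d e f -> hexa T b c d e f a.
Proof.
move/hexaE=> [[? ? ?] [? ? ?] u]; do 6![apply/andP; split=> //].
by rewrite -(rot_uniq 1) in u.
Qed.

Lemma hexa_not_quad a b c d e f g h :
  hexa T a b c d e f -> ~~ quad T a b g h.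
Proof. by move=> H; apply/negP=> Q; clash. Qed.

Lemma hexa_fun a b c d e f c' d' e' f' :
  hexa T a b c d e f -> hexa T a b c' d' e' f' ->
  [:: c'; d'; e'; f'] = [:: c; d; e; f].
Proof. by move=> H H'; unpack; saturate. Qed.

(** * Hexagonal tubes *)

Definition hex_corner a x b := exists d e f, hexa T a x b d e f.

(** If all vertices of a set satisfy this with lists inside the set, then the set is closed under
    adjacency and meets no square. *)
Definition hex_vertex x (L : seq V) := exists a b c,
  [/\ hex_corner a x b, hex_corner b x c, hex_corner c x a
    & [&& a \in L, b \in L & c \in L]].

Lemma hex_vertex_nbr x L y : hex_vertex x L -> adj x y -> y \in L.
Proof.
move=> [a [b [c [[? [? [? H]]] [? [? [? H']]] _ /and3P[aL bL cL]]]]] xy.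
have := turn_nbrs (proj1 (andP H)) (proj1 (andP H')) xy.
by rewrite !inE => /or3P[] /eqP->.
Qed.

Lemma hex_vertex_no_quad x L p q r : hex_vertex x L -> ~~ quad T p x q r.
Proof.
have corner a b : hex_corner a x b -> ~~ quad T a x q r.
  by case=> d [e [f /hexa_not_quad]].
move=> [a [b [c [Ha Hb Hc _]]]]; apply/negP=> Q.
case: (Ha) (Hb) => ? [? [? /andP[h _]]] [? [? [? /andP[h' _]]]].
have := turn_nbrs h h' (c46_adjl M (proj1 (andP Q))).
rewrite !inE => /or3P[] /eqP E; move: Q; rewrite E; apply/negP.
- exact: corner Ha.
- exact: corner Hb.
exact: corner Hc.
Qed.

(* Discard the elements without a predecessor, one at a time. *)
Lemma succ_pred_core (S : finType) (e : rel S) (A : {set S}) :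
  A != set0 -> (forall x, x \in A -> exists2 y, y \in A & e x y) ->
  exists2 B : {set S}, B != set0 & forall x, x \in B ->
    (exists2 y, y \in B & e x y) /\ (exists2 y, y \in B & e y x).
Proof.
move: {2}#|A| (leqnn #|A|) => n; elim: n A => [|n IH] A leA A0 succ.
  by move: leA; rewrite leqn0 cards_eq0 (negPf A0).
case: (boolP [forall x in A, exists y in A, e y x]) => [/forall_inP pred|].
  exists A => // x xA; split; first exact: succ.
  by case/exists_inP: (pred x xA) => y yA eyx; exists y.
rewrite negb_forall_in => /exists_inP[x xA].
rewrite negb_exists_in => /forall_inP nopred.
apply: (IH (A :\ x)).
- by move: leA; rewrite (cardsD1 x) xA add1n ltnS.
- case: (succ x xA) => y yA exy; apply/set0Pn; exists y; rewrite !inE yA andbT.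
  by apply: contraTneq exy => ->; apply: nopred.
move=> z; rewrite !inE => /andP[_ zA]; case: (succ z zA) => y yA ezy.
exists y => //; rewrite !inE yA andbT.
by apply: contraTneq ezy => ->; apply: nopred.
Qed.

(* A family of rings that never ends wraps around into a hexagonal torus,
   which would be the whole graph. *)
Lemma no_tube (S : finType) (verts : S -> seq V) (e : rel S) (A : {set S}) :
  (forall s, verts s != [::]) ->
  (forall p s n, e p s -> e s n -> forall x, x \in verts s ->
     hex_vertex x (verts p ++ verts s ++ verts n)) ->
  (forall x, x \in A -> exists2 y, y \in A & e x y) -> A = set0.
Proof.
move=> verts0 inner succ; apply/eqP; apply: contraT => A0.
have [B B0 core] := succ_pred_core A0 succ.
(* [W] gathers the vertices of the rings in the core. It is closed under adjacency, so by
   connectedness it contains a vertex of the square given by [c46_quad]. *)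
pose W := [pred x | [exists s in B, x \in verts s]].
have WP x s : s \in B -> x \in verts s -> x \in W.
  by move=> sB xs; apply/exists_inP; exists s.
have hexW x : x \in W -> exists2 L, hex_vertex x L & {subset L <= W}.
  case/exists_inP=> s sB xs.
  case: (core s sB) => [[n nB esn] [p pB eps]].
  exists (verts p ++ verts s ++ verts n); first exact: inner xs.
  by move=> y; rewrite !mem_cat => /or3P[]; apply: WP.
have closedW x y : connect adj x y -> x \in W -> y \in W.
  case/connectP=> p; elim: p x => [x _ -> //|z p IH x /= /andP[xz pz] Ey xW].
  apply: IH pz Ey _; case: (hexW x xW) => L hx; apply.
  exact: hex_vertex_nbr hx xz.
case/set0Pn: B0 => s sB.
have [x xs] : exists x, x \in verts s.
  by case: (verts s) (verts0 s) => // x l _; exists x; rewrite inE eqxx.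
have [a [b [c [d Q]]]] := c46_quad M.
have [L hb _] := hexW b (closedW _ _ (c46_conn M x b) (WP _ _ sB xs)).
by rewrite (negPf (hex_vertex_no_quad _ _ _ hb)) in Q.
Qed.

Ltac hexcorner :=
  do 3!eexists; solve [eassumption
    | apply: hexa_rot; eassumption
    | do 2![apply: hexa_rot]; eassumption
    | do 3![apply: hexa_rot]; eassumption
    | do 4![apply: hexa_rot]; eassumption
    | do 5![apply: hexa_rot]; eassumption].

Ltac hexvertex a b c := exists a, b, c; split; [hexcorner .. |
  by rewrite !mem_cat !inE !eqxx ?orbT].

(* A 4-cycle with left edges at its second and fourth vertices. *)
Definition ring4 (s : V * V * V * V) :=
  let: (z, v, t, y) := s in [&& T y z v, T t v z, T v t y & T z y t].

Definition step4 (s n : V * V * V * V) :=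
  let: (z, v, t, y) := s in let: (u, m, u', m') := n in
  hexa T u v t y u' m && hexa T u' y z v u m'.

(** A square on one left face makes both left edges end at the same vertex; the other face then
    turns there in the opposite sense or visits it twice. So both faces are hexagons, and the ends
    u, u' of the left edges form the next 4-cycle with the last vertices m, m' of the hexagons. *)
Lemma ring4_step s : ring4 s -> exists2 n, ring4 n & step4 s n.
Proof.
case: s => [[[z v] t] y] /and4P[yzv tvz vty zyt].
have [u [zvu uvt]] := turn_third tvz; have [u' [tyu' u'yz]] := turn_third zyt.
case: (gap2 uvt vty tyu') => [[E Q]|[m H]];
  case: (gap2 u'yz yzv zvu) => [[E' Q']|[m' H']]; try clash.
exists (u, m, u', m'); rewrite /ring4 /step4 ?H ?H' //.
unpack; apply/and4P; split=> //.
- by apply: turn_close (_ : T m u v) _.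
- by apply: turn_close (_ : T m' u' y) _.
Qed.

Lemma no_ring4 s : ~~ ring4 s.
Proof.
pose verts (s : V * V * V * V) := let: (z, v, t, y) := s in [:: z; v; t; y].
have A0 : [set s | ring4 s] = set0.
  apply: (@no_tube _ verts step4).
  - by case=> [[[? ?] ?] ?].
  - case=> [[[p0 p1] p2] p3] [[[c0 c1] c2] c3] [[[n0 n1] n2] n3].
    case/andP=> H1 H2 /andP[H3 H4] x; rewrite !inE => /or4P[] /eqP->.
    + by hexvertex c3 c1 p1.
    + by hexvertex c2 c0 n0.
    + by hexvertex c1 c3 p3.
    + by hexvertex c0 c2 n2.
  - by move=> s'; rewrite inE => /ring4_step[n rn sn]; exists n; rewrite ?inE.
by apply/negP=> rs; move/setP/(_ s): A0; rewrite !inE rs.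
Qed.

(* The digits are the gaps between consecutive left edges, the first of which
   is at c0. *)
Lemma no_left1 c0 c1 c2 c3 c4 c5 : uniq [:: c0; c1; c2; c3; c4; c5] ->
  T c1 c0 c5 -> T c0 c1 c2 -> T c1 c2 c3 -> T c2 c3 c4 -> T c3 c4 c5 ->
  T c4 c5 c0 -> False.
Proof.
move=> u /turn_third[t [h1 h2]] h3 h4 h5 h6 h7.
have ne : c0 != c4 by apply: contraTneq u => ->; rewrite /= !inE eqxx !orbT.
by have [E H] := gap4 ne h2 h3 h4 h5 h6; clash.
Qed.

(** The face along c0, ..., c4 would have to close up at c5, but the left edge at c0 does not lead
    to c5. *)
Lemma no_left51 c0 c1 c2 c3 c4 c5 : uniq [:: c0; c1; c2; c3; c4; c5] ->
  T c1 c0 c5 -> T c0 c1 c2 -> T c1 c2 c3 -> T c2 c3 c4 -> T c3 c4 c5 ->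
  T c0 c5 c4 -> False.
Proof.
move=> u /turn_third[t [h1 h2]] h3 h4 h5 h6 h7.
have ne : c0 != c4 by apply: contraTneq u => ->; rewrite /= !inE eqxx !orbT.
by have [E H] := gap4 ne h2 h3 h4 h5 h6; clash.
Qed.

(** The gap 4 makes both left edges end at one vertex; the face along the gap 2 is then a square
    with the opposite turn there, or a hexagon visiting it twice. *)
Lemma no_left42 c0 c1 c2 c3 c4 c5 : uniq [:: c0; c1; c2; c3; c4; c5] ->
  T c1 c0 c5 -> T c0 c1 c2 -> T c1 c2 c3 -> T c2 c3 c4 -> T c5 c4 c3 ->
  T c4 c5 c0 -> False.
Proof.
move=> u /turn_third[t [h1 h2]] h3 h4 h5 /turn_third[t' [h6 h6']] h7.
have ne : c0 != c4 by apply: contraTneq u => ->; rewrite /= !inE eqxx !orbT.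
have [E H] := gap4 ne h2 h3 h4 h5 h6.
by case: (gap2 h6' h7 h1) => [[E' Q]|[v H']]; clash.
Qed.

(** A square on either side gives the chord. Two hexagons would turn in opposite senses at the outer
    end of a left edge. *)
Lemma left33_chord c0 c1 c2 c3 c4 c5 :
  T c1 c0 c5 -> T c0 c1 c2 -> T c1 c2 c3 -> T c4 c3 c2 -> T c3 c4 c5 ->
  T c4 c5 c0 -> adj c0 c3.
Proof.
move=> /turn_third[t [h1 h2]] h3 h4 /turn_third[t' [h5 h5']] h6 h7.
case: (gap3 h2 h3 h4 h5) => [[E _ _]|H].
  by rewrite -E; apply: c46_adjr M _ _ _ h1.
case: (gap3 h5' h6 h7 h1) => [[_ E _]|H']; last by clash.
by rewrite -E; apply: c46_adjr M _ _ _ h1.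
Qed.

(** The gap 4 makes the left edges at c0 and c4 meet in w. The faces along the gaps 1 must be
    hexagons, which share the third edge w - z; their remaining vertices z, v, t, y form a
    [ring4]. *)
Lemma no_left411 c0 c1 c2 c3 c4 c5 : uniq [:: c0; c1; c2; c3; c4; c5] ->
  T c1 c0 c5 -> T c0 c1 c2 -> T c1 c2 c3 -> T c2 c3 c4 -> T c5 c4 c3 ->
  T c0 c5 c4 -> False.
Proof.
move=> u /turn_third[w [h1 h2]] h3 h4 h5 /turn_third[w' [h6 h6']].
case/turn_third=> t [h7 h8].
have ne : c0 != c4 by apply: contraTneq u => ->; rewrite /= !inE eqxx !orbT.
have [E H] := gap4 ne h2 h3 h4 h5 h6; subst w'.
have hw : T c4 w c0 by case/hexaE: H => _ [].
case: (gap1 h6' h7) => [Q|[v [z H1]]]; case: (gap1 h8 h1) => [Q'|[z' [y H2]]].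
- by clash.
- have hc : T c0 w t by apply: turn_close hw; case/quadE: Q.
  by clash.
- have hc : T t w c4 by apply: turn_close hw _; case/quadE: Q'.
  by clash.
have hc : T c0 w z by apply: turn_close hw; case/hexaE: H1 => _ [].
have Ez : z = z' by apply: c46_fun M _ _ _ _ hc _; case/hexaE: H2 => [[]].
subst z'; apply/negP: (no_ring4 (z, v, t, y)); rewrite negbK.
unpack; apply/and4P; split=> //.
- by apply: turn_close (_ : T v z w) _.
- by apply: turn_close (_ : T y t c5) _.
Qed.

(** * Rings with gaps (3,2,1) *)

Local Notation V6 := (V * V * V * V * V * V)%type.

Definition verts6 (s : V6) :=
  let: (c0, c1, c2, c3, c4, c5) := s in [:: c0; c1; c2; c3; c4; c5].

Definition ring321 (s : V6) :=
  let: (c0, c1, c2, c3, c4, c5) := s in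
  [&& T c1 c0 c5, T c0 c1 c2, T c1 c2 c3, T c4 c3 c2, T c3 c4 c5 & T c0 c5 c4].

(** The spokes are c0 - d1, c3 - d2 and c5 - d4; the left edges of the next ring start at d0, d3,
    d5, again with gaps 3, 2, 1. *)
Definition step321 (s n : V6) :=
  let: (c0, c1, c2, c3, c4, c5) := s in
  let: (d0, d1, d2, d3, d4, d5) := n in
  [&& hexa T d1 c0 c1 c2 c3 d2, hexa T d2 c3 c4 c5 d4 d3
    & hexa T d4 c5 c0 d1 d0 d5].

Lemma ring321_step s : ring321 s -> exists2 n, ring321 n & step321 s n.
Proof.
case: s => [[[[[c0 c1] c2] c3] c4] c5] /=.
case/andP=> /turn_third[t0 [h0 h0']] /and5P[h1 h2 /turn_third[t3 [h3 h3']] h4].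
case/turn_third=> t5 [h5 h5'].
case: (gap3 h0' h1 h2 h3) => [[E3 E0 Q]|H1].
  subst t0 t3; case: (gap1 h5' h0) => [Q'|[v [v' H]]]; clash.
case: (gap2 h3' h4 h5) => [[E Q2]|[v H2]]; last first.
  case: (gap1 h5' h0) => [Q3|[u [u' H3]]]; last first.
    exists (u, t0, t3, v, t5, u'); last by rewrite /step321 H1 H2 H3.
    unpack; apply/andP; split=> //; apply/and5P; split=> //.
    - by apply: turn_close (_ : T t3 t0 c0) _.
    - by apply: turn_close (_ : T v t3 c3) _.
    - by apply: turn_close (_ : T u' t5 c5) _.
  (* With a square along c5 - c0, the vertices t0, t3, v, t5 form a 4-cycle whose only left edge is
     at v. The face along it cannot close up properly. *)
  have k0 : T t5 t0 t3.
    by apply: turn_close (_ : T t3 t0 c0) _; unpack.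
  have k3 : T t0 t3 v.
    by apply: turn_close (_ : T v t3 c3) _; unpack.
  have k5 : T v t5 t0.
    by apply: turn_close (_ : T t0 t5 c5) _; unpack.
  have kv : T t5 v t3 by unpack.
  have [u [l1 l2]] := turn_third kv.
  by case: (gap3 l2 k5 k0 k3) => [[E E' Q]|H]; clash.
subst t5; case: (gap1 h5' h0) => [Q3|[u [u' H3]]]; first by clash.
have k : T t0 t3 c5.
  by apply: turn_close (_ : T c5 t3 c3) _; unpack.
by clash.
Qed.

Lemma no_ring321 s : ~~ ring321 s.
Proof.
have A0 : [set s | ring321 s] = set0.
  apply: (@no_tube _ verts6 step321).
  - by case=> [[[[[? ?] ?] ?] ?] ?].
  - case=> [[[[[p0 p1] p2] p3] p4] p5] [[[[[c0 c1] c2] c3] c4] c5].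
    case=> [[[[[n0 n1] n2] n3] n4] n5] /and3P[P1 P2 P3] /and3P[N1 N2 N3] x.
    rewrite !inE => /orP[/eqP->|/orP[/eqP->|/or4P[] /eqP->]].
    + by hexvertex c1 c5 n1.
    + by hexvertex c0 c2 p0.
    + by hexvertex c1 c3 p3.
    + by hexvertex c4 c2 n2.
    + by hexvertex c3 c5 p5.
    + by hexvertex c0 c4 n4.
  - by move=> s'; rewrite inE => /ring321_step[n rn sn]; exists n; rewrite ?inE.
by apply/negP=> rs; move/setP/(_ s): A0; rewrite !inE rs.
Qed.

Lemma no_left321 c0 c1 c2 c3 c4 c5 :
  T c1 c0 c5 -> T c0 c1 c2 -> T c1 c2 c3 -> T c4 c3 c2 -> T c3 c4 c5 ->
  T c0 c5 c4 -> False.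
Proof.
move=> h0 h1 h2 h3 h4 h5; apply/negP: (no_ring321 (c0, c1, c2, c3, c4, c5)).
by rewrite negbK /= h0 h1 h2 h3 h4 h5.
Qed.

(** * Rings with gaps (2,2,2) *)

(** Distinctness is included because these rings become the 6-cycles of [S_k]. *)
Definition ring222 (s : V6) :=
  let: (c0, c1, c2, c3, c4, c5) := s in
  uniq (verts6 s) &&
  [&& T c1 c0 c5, T c0 c1 c2, T c3 c2 c1, T c2 c3 c4, T c5 c4 c3 & T c4 c5 c0].

Definition cap222 (s : V6) (w : V) :=
  let: (c0, c1, c2, c3, c4, c5) := s in
  [&& quad T w c0 c1 c2, quad T w c2 c3 c4 & quad T w c4 c5 c0].

(* The ring [n] is indexed so as to start at a left vertex, like [s]; the spokes
   are therefore c0 - d5, c2 - d1 and c4 - d3. *)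
Definition step222 (s n : V6) :=
  let: (c0, c1, c2, c3, c4, c5) := s in
  let: (d0, d1, d2, d3, d4, d5) := n in
  [&& hexa T d5 c0 c1 c2 d1 d0, hexa T d1 c2 c3 c4 d3 d2
    & hexa T d3 c4 c5 c0 d5 d4].

(** The square makes its two left edges meet in w, so both hexagons use the third edge w - v and
    turn at v in opposite senses. *)
Lemma no_one_square w c0 c1 c2 c3 c4 c5 t4 v v' :
  quad T w c0 c1 c2 -> hexa T w c2 c3 c4 t4 v -> hexa T t4 c4 c5 c0 w v' ->
  False.
Proof.
move=> Q H H'.
have k : T c0 w v.
  by apply: turn_close (_ : T c2 w c0); unpack.
by clash.
Qed.

(** By the number of squares among the three left faces: three form the cap; two identify the ends
    of all left edges, so that the hexagon repeats a vertex; one is excluded by [no_one_square];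
    none gives the next ring. *)
Lemma ring222_step s : ring222 s ->
  (exists w, cap222 s w) \/ exists2 n, ring222 n & step222 s n.
Proof.
case: s => [[[[[c0 c1] c2] c3] c4] c5] /andP[_].
case/andP=> /turn_third[t0 [h0 h0']] /and5P[h1 /turn_third[t2 [h2 h2']] h3].
case/turn_third=> t4 [h4 h4'] h5.
case: (gap2 h0' h1 h2) => [[E1 Q1]|[v1 H1]];
  case: (gap2 h2' h3 h4) => [[E3 Q3]|[v3 H3]];
  case: (gap2 h4' h5 h0) => [[E5 Q5]|[v5 H5]].
- by left; exists t0; subst; rewrite /= Q1 Q3 Q5.
- by exfalso; clash.
- by exfalso; clash.
- by exfalso; subst; apply: no_one_square Q1 H3 H5.
- by exfalso; clash.
- by exfalso; subst; apply: no_one_square Q3 H5 H1.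
- by exfalso; subst; apply: no_one_square Q5 H1 H3.
right; exists (v1, t2, v3, t4, v5, t0); last by rewrite /= H1 H3 H5.
have k1 : T v1 t2 v3.
  by apply: turn_close (_ : T v3 t2 c2) _; unpack.
have k3 : T v3 t4 v5.
  by apply: turn_close (_ : T v5 t4 c4) _; unpack.
have k5 : T v5 t0 v1.
  by apply: turn_close (_ : T v1 t0 c0) _; unpack.
have neq a b c : T a b c -> a != c.
  by apply: contraTneq => ->; rewrite turn_neq.
have adjl := c46_adjl M; have adjr := c46_adjr M.
unpack; do 1?[apply/andP; split]; last first.
  by apply/andP; split=> //; apply/and5P; split.
apply: closed_walk6_uniq.
  by do ![apply/andP; split];
    first [apply: adjr; eassumption | apply: adjl; eassumption].
by do ![apply/andP; split];
  first [apply: neq; eassumption | rewrite eq_sym; apply: neq; eassumption].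
Qed.

Lemma tube222 p s n : step222 p s -> step222 s n ->
  forall x, x \in verts6 s -> hex_vertex x (verts6 p ++ verts6 s ++ verts6 n).
Proof.
case: p s n => [[[[[p0 p1] p2] p3] p4] p5] [[[[[c0 c1] c2] c3] c4] c5].
case=> [[[[[n0 n1] n2] n3] n4] n5] /and3P[P1 P2 P3] /and3P[N1 N2 N3] x.
rewrite !inE => /orP[/eqP->|/orP[/eqP->|/or4P[] /eqP->]].
+ by hexvertex c1 c5 n5.
+ by hexvertex c0 c2 p2.
+ by hexvertex c3 c1 n1.
+ by hexvertex c2 c4 p4.
+ by hexvertex c5 c3 n3.
+ by hexvertex c4 c0 p0.
Qed.

(** If no ring reachable from [s] bounded a cap, every reachable ring would have a successor,
    against [no_tube]. *)
Lemma ring222_cap s : ring222 s -> exists p, exists2 w,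
  path [rel x y | ring222 y && step222 x y] s p & cap222 (last s p) w.
Proof.
move=> rs; set e := [rel x y | _].
case: (boolP [exists n, connect e s n && [exists w, cap222 n w]]).
  case/existsP=> n /andP[/connectP[p ep ->] /existsP[w cap]].
  by exists p, w.
rewrite negb_exists => /forallP nocap.
have ring_connect n : connect e s n -> ring222 n.
  case/connectP=> p; elim: p s rs {nocap} => [s' rs' _ -> //|y p IH s' _].
  by case/andP=> /andP[ry _] ep; apply: IH.
have A0 : [set n | connect e s n] = set0.
  apply: (@no_tube _ verts6 step222).
  - by case=> [[[[[? ?] ?] ?] ?] ?].
  - exact: tube222.
  move=> n; rewrite inE => sn; have rn := ring_connect n sn.
  case: (ring222_step rn) => [[w cap]|[m rm st]].
    by move: (nocap n); rewrite sn /= => /existsP[]; exists w.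
  exists m => //; rewrite inE; apply: connect_trans sn (connect1 _).
  by rewrite /= rm st.
by move/setP/(_ s): A0; rewrite !inE connect0.
Qed.

(** * Cyclic indexing of rings *)

Definition ringf (s : V6) n := nth s.1.1.1.1.1 (verts6 s) (n %% 6).

Lemma ringf_modl s n m : ringf s (n %% 6 + m) = ringf s (n + m).
Proof. by rewrite /ringf modnDml. Qed.

Lemma ringf_mod s n : ringf s (n %% 6) = ringf s n.
Proof. by rewrite /ringf modn_mod. Qed.

Lemma ringf_inj s n m : uniq (verts6 s) -> ringf s n = ringf s m ->
  n = m %[mod 6].
Proof.
have sz : size (verts6 s) = 6 by case: s => [[[[[? ?] ?] ?] ?] ?].
by move=> u /eqP; rewrite nth_uniq ?sz ?ltn_pmod // => /eqP.
Qed.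

Lemma ringf_mem s n : ringf s n \in verts6 s.
Proof.
by apply: mem_nth; case: s => [[[[[? ?] ?] ?] ?] ?]; apply: ltn_pmod.
Qed.

Lemma mem_ringf s x : x \in verts6 s -> exists n, x = ringf s n.
Proof.
move=> xs; exists (index x (verts6 s)); rewrite /ringf modn_small ?nth_index //.
by move: xs; rewrite -index_mem; case: s => [[[[[? ?] ?] ?] ?] ?].
Qed.

Lemma mod6_ind (P : nat -> Prop) :
  P 0 -> P 1 -> P 2 -> P 3 -> P 4 -> P 5 -> forall n, P (n %% 6).
Proof.
move=> P0 P1 P2 P3 P4 P5 n; have : n %% 6 < 6 by apply: ltn_pmod.
by case: (n %% 6) => [|[|[|[|[|[|?]]]]]].
Qed.

Lemma ring222_adj s n : ring222 s -> adj (ringf s n) (ringf s n.+1).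
Proof.
rewrite -(ringf_mod s n) -[n.+1]addn1 -ringf_modl.
case: s => [[[[[c0 c1] c2] c3] c4] c5] /andP[_].
do 5![case/andP=> ?]; move=> ?; have adjl := c46_adjl M.
have adjr := c46_adjr M.
elim/mod6_ind: (n %% 6) => /=; first [apply: adjr; eassumption
  | apply: adjl; eassumption].
Qed.

(** The spokes d1 - c2, d3 - c4, d5 - c0 raise the index by one, which is why the shift [r] of
    [layered] grows by one with each layer. *)
Lemma step222_spoke s d n : step222 s d -> odd n ->
  adj (ringf d n) (ringf s n.+1).
Proof.
rewrite -(odd_mod n (erefl : odd 6 = false)).
rewrite -(ringf_mod d n) -[n.+1]addn1 -ringf_modl.
case: s d => [[[[[c0 c1] c2] c3] c4] c5] [[[[[d0 d1] d2] d3] d4] d5].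
case/and3P=> H1 H2 H3; have adjl := c46_adjl M; unpack.
by elim/mod6_ind: (n %% 6) => //= _; apply: adjl; eassumption.
Qed.

(** * Layers around a cap *)

Definition layer_vertex k w (g : nat -> nat -> V) x :=
  x = w \/ exists i j, i <= k /\ x = g i j.

(* [s] is the outer ring of k layers around the apex w. Its vertices c1, c3, c5
   are the ones with a neighbour outside. *)
Record layered k (s : V6) (w : V) (g : nat -> nat -> V) (r : nat) : Prop :=
  Layered {
  ly_shift : odd (r + k);
  ly_outer : forall j, g k j = ringf s (j + r);
  ly_mod : forall i j, i <= k -> g i (j %% 6) = g i j;
  ly_apex : forall j, odd j -> adj w (g 0 j);
  ly_ring : forall i j, i <= k -> adj (g i j) (g i j.+1);
  ly_spoke : forall i j, i < k -> odd j = odd i -> adj (g i j) (g i.+1 j);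
  ly_inj : forall i i' j j', i <= k -> i' <= k -> g i j = g i' j' ->
    i = i' /\ j = j' %[mod 6];
  ly_apexN : forall i j, i <= k -> w <> g i j;
  ly_closed : let: (c0, c1, c2, c3, c4, c5) := s in
    forall x y, layer_vertex k w g x -> x \notin [:: c1; c3; c5] -> adj x y ->
    layer_vertex k w g y /\
    [/\ y = c1 -> x \in [:: c0; c2], y = c3 -> x \in [:: c2; c4]
      & y = c5 -> x \in [:: c4; c0]]
}.

Ltac not_uniq u E :=
  by move: u; rewrite E /= !inE ?eqxx ?orbT /= ?andbF.

Ltac outer_nbrs us nw := let z := fresh in let E := fresh in
  move=> z; rewrite !inE => /or3P[] /eqP->; (split;
  [by rewrite ?eqxx ?orbT | split=> E;
   solve [by rewrite ?eqxx ?orbT | not_uniq us E | not_uniq nw E]]).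

Ltac outer_edge inS us := let E := fresh in
  split; [by apply: inS; rewrite !inE ?eqxx ?orbT | split=> E;
   solve [by rewrite !inE ?eqxx ?orbT | not_uniq us E]].

Lemma cap222_apex s w : cap222 s w -> w \notin verts6 s.
Proof.
case: s => [[[[[c0 c1] c2] c3] c4] c5] /and3P[Q1 Q2 Q3].
by rewrite !inE; apply/negP => /orP[/eqP E|/orP[/eqP E|/or4P[] /eqP E]];
  subst; clash.
Qed.

(** The apex is joined to c0, c2, c4, while in [S_k] it is joined to odd indices; hence the initial
    shift 1. *)
Lemma layered_cap s w : ring222 s -> cap222 s w ->
  layered 0 s w (fun _ j => ringf s (j + 1)) 1.
Proof.
move=> rs cap; have us : uniq (verts6 s).
  by case: s rs {cap} => [[[[[? ?] ?] ?] ?] ?] /andP[].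
split=> //.
- by move=> i j _; rewrite ringf_modl.
- move=> j; rewrite -(odd_mod j (erefl : odd 6 = false)) -ringf_modl.
  case: s cap {rs us} => [[[[[c0 c1] c2] c3] c4] c5] /and3P[Q1 Q2 Q3].
  have adjr := c46_adjr M; unpack.
  by elim/mod6_ind: (j %% 6) => //= _; apply: adjr; eassumption.
- by move=> i j _; rewrite addSn; apply: ring222_adj.
- move=> [|//] [|//] j j' _ _ /(ringf_inj us) /eqP.
  by rewrite eqn_modDr => /eqP.
- by move=> i j _ E; move: (cap222_apex cap); rewrite E ringf_mem.
have lyP x : layer_vertex 0 w (fun _ j => ringf s (j + 1)) x <->
    x \in w :: verts6 s.
  rewrite inE; split=> [[->|[_ [j [_ ->]]]]|/orP[/eqP->|/mem_ringf[n ->]]].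
  - by rewrite eqxx.
  - by rewrite ringf_mem orbT.
  - by left.
  (* Adding 5 undoes the shift 1 modulo 6. *)
  right; exists 0, (n + 5); split=> //.
  by rewrite -addnA -(ringf_mod _ (n + _)) -[5 + 1]/6 modnDr ringf_mod.
case: s rs us cap lyP => [[[[[c0 c1] c2] c3] c4] c5] /andP[_] R us.
move=> cap lyP x y; have nw := cap222_apex cap; case/and3P: cap => Q1 Q2 Q3.
move=> /lyP xL xN xy.
have [L yL nbr] : exists2 L : seq V, y \in L & {in L, forall y : V,
    y \in [:: w; c0; c1; c2; c3; c4; c5] /\
    [/\ y = c1 -> x \in [:: c0; c2], y = c3 -> x \in [:: c2; c4]
      & y = c5 -> x \in [:: c4; c0]]}; last first.
  by case: (nbr y yL) => /lyP.
unpack; clear R; move: xL xN; rewrite !inE.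
case/orP=> [/eqP Ex|/orP[/eqP Ex|/orP[/eqP Ex|/or4P[] /eqP Ex]]]; subst x;
  rewrite ?eqxx ?orbT //= => _.
- exists [:: c4; c2; c0]; first exact: turn_nbrs xy.
  by outer_nbrs us nw.
- exists [:: c5; w; c1]; first exact: turn_nbrs xy.
  by outer_nbrs us nw.
- exists [:: c1; w; c3]; first exact: turn_nbrs xy.
  by outer_nbrs us nw.
- exists [:: c3; w; c5]; first exact: turn_nbrs xy.
  by outer_nbrs us nw.
Qed.


Lemma mem3 (x a b c : V) : x \in [:: a; b; c] -> [\/ x = a, x = b | x = c].
Proof.
by rewrite !inE => /or3P[] /eqP ->;
  [constructor 1 | constructor 2 | constructor 3].
Qed.

Lemma step222_nbrs c0 c1 c2 c3 c4 c5 d0 d1 d2 d3 d4 d5 y :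
  step222 (c0, c1, c2, c3, c4, c5) (d0, d1, d2, d3, d4, d5) ->
  [/\ adj d1 y -> y \in [:: d2; c2; d0], adj d3 y -> y \in [:: d4; c4; d2]
    & adj d5 y -> y \in [:: d0; c0; d4]] /\
  [/\ adj c0 y -> y \in [:: c5; d5; c1], adj c2 y -> y \in [:: c1; d1; c3]
    & adj c4 y -> y \in [:: c3; d3; c5]].
Proof.
case/and3P=> H1 H2 H3; unpack.
by split; split; apply: turn_nbrs; eassumption.
Qed.

Lemma layer_vertexS k w g h x :
  layer_vertex k.+1 w (fun i j => if i <= k then g i j else h j) x <->
  layer_vertex k w g x \/ exists j, x = h j.
Proof.
split=> [[->|[i [j [_ ->]]]]|[[->|[i [j [ik ->]]]]|[j ->]]].
- by left; left.
- case: ifP => ik; last by right; exists j.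
  by left; right; exists i, j.
- by left.
- by right; exists i, j; rewrite ik leqW.
by right; exists k.+1, j; rewrite ltnn.
Qed.

(** The main point is that [s] avoids the earlier layers. This comes from [ly_closed], which is then
    established again with [s] as outer ring. *)
Lemma layered_step k s d w g r : ring222 s -> step222 s d ->
  layered k d w g r ->
  layered k.+1 s w
    (fun i j => if i <= k then g i j else ringf s (j + r.+1)) r.+1.
Proof.
move=> rs st [shift outer gmod apex gring spoke inj apexN closed].
have us : uniq (verts6 s).
  by case: s rs {st} => [[[[[? ?] ?] ?] ?] ?] /andP[].
have dB x : x \in verts6 d -> layer_vertex k w g x.
  (* Adding the shift r gives n + 6 * r, which is n modulo 6. *)
  case/mem_ringf=> n ->; right; exists k, (n + 5 * r); split=> //.
  rewrite outer -addnA -mulSnr -(ringf_mod d (n + _)) -modnDmr.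
  by rewrite modnMr addn0 ringf_mod.
have sB x : x \in verts6 s -> ~ layer_vertex k w g x.
  case: s d st rs dB closed {us outer shift} => [[[[[c0 c1] c2] c3] c4] c5].
  case=> [[[[[d0 d1] d2] d3] d4] d5] st _ dB closed.
  case/and3P: (st) => H1 H2 H3.
  have [A1 A2] : [/\ adj c0 d5, adj c2 d1 & adj c4 d3] /\
      [/\ adj c1 c0, adj c3 c2 & adj c5 c4].
    by have adjl := c46_adjl M; unpack; do !split; apply: adjl; eassumption.
  (* Such a vertex is none of d1, d3, d5 but is joined to one of them by a spoke. Were it in the
     layers, [closed] would place it among d0, d2, d4, against the hexagons. *)
  have even z : z \in [:: c0; c2; c4] -> ~ layer_vertex k w g z.
    move=> zc lz; have nd : z \notin [:: d1; d3; d5].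
      by apply/negP; move: zc; rewrite !inE => /or3P[] /eqP-> /or3P[] /eqP E;
        subst; clash.
    case: A1 => a0 a2 a4; move: zc; rewrite !inE.
    case/or3P=> /eqP E; rewrite E in lz nd.
    + have [_ [_ _ /(_ erefl)]] := closed _ _ lz nd a0.
      by rewrite !inE => /orP[] /eqP ?; subst; clash.
    + have [_ [/(_ erefl)]] := closed _ _ lz nd a2.
      by rewrite !inE => /orP[] /eqP ?; subst; clash.
    + have [_ [_ /(_ erefl)]] := closed _ _ lz nd a4.
      by rewrite !inE => /orP[] /eqP ?; subst; clash.
  (* The ring neighbours of d1, d3, d5 lie in the layers while [e] does not, so the edge is a
     spoke. *)
  have oddc z e : z \in [:: d1; d3; d5] -> adj z e -> e \in [:: c0; c2; c4] ->
      [|| (z == d1) && (e == c2), (z == d3) && (e == c4)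
        | (z == d5) && (e == c0)].
    move=> zd ze ec; have [[n1 n3 n5] _] := step222_nbrs e st.
    have nd d : d \in [:: d0; d2; d4] -> e <> d.
      move=> dd E; apply: (even e ec); rewrite E; apply: dB.
      by move: dd; rewrite !inE => /or3P[] ->; rewrite ?orbT.
    have [m0 m2 m4] : [/\ e != d0, e != d2 & e != d4].
      by split; apply/eqP; apply: nd; rewrite !inE eqxx ?orbT.
    move: zd; rewrite !inE => /or3P[] /eqP E; rewrite E eqxx in ze *.
    - by move/n1: ze; rewrite !inE (negPf m0) (negPf m2) orbF /= => ->.
    - by move/n3: ze; rewrite !inE (negPf m2) (negPf m4) orbF /= => ->;
        rewrite /= ?orbT.
    - by move/n5: ze; rewrite !inE (negPf m0) (negPf m4) orbF /= => ->;
        rewrite /= ?orbT.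
  (* If c1, c3 or c5 were in the layers, its neighbour c0, c2 or c4 would be there too by [closed],
     or the edge between them would be a spoke by [oddc]. *)
  move=> xs; case: A2 => a1 a3 a5.
  have : x \in [:: c0; c2; c4] ++ [:: c1; c3; c5].
    move: xs; rewrite !inE.
    by case/orP=> [->|/orP[->|/or4P[] ->]]; rewrite ?orbT.
  rewrite mem_cat => /orP[/even//|]; rewrite !inE => /or3P[] /eqP->.
  + move=> l1; case: (boolP (c1 \in [:: d1; d3; d5])) => [cd|nd].
      move: (oddc _ _ cd a1); rewrite !inE eqxx => /(_ isT).
      by case/or3P=> /andP[/eqP ? /eqP ?]; subst; clash.
    by case: (closed _ _ l1 nd a1) => l0 _; apply: even l0;
      rewrite !inE eqxx.
  + move=> l1; case: (boolP (c3 \in [:: d1; d3; d5])) => [cd|nd].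
      move: (oddc _ _ cd a3); rewrite !inE eqxx orbT => /(_ isT).
      by case/or3P=> /andP[/eqP ? /eqP ?]; subst; clash.
    by case: (closed _ _ l1 nd a3) => l0 _; apply: even l0;
      rewrite !inE eqxx orbT.
  + move=> l1; case: (boolP (c5 \in [:: d1; d3; d5])) => [cd|nd].
      move: (oddc _ _ cd a5); rewrite !inE eqxx !orbT => /(_ isT).
      by case/or3P=> /andP[/eqP ? /eqP ?]; subst; clash.
    by case: (closed _ _ l1 nd a5) => l0 _; apply: even l0;
      rewrite !inE eqxx !orbT.
split.
- by rewrite addSn addnS /= negbK.
- by move=> j; rewrite ltnn.
- move=> i j; rewrite leq_eqVlt => /orP[/eqP->|ik].
    by rewrite ltnn ringf_modl.
  by rewrite -ltnS ik gmod.
- by move=> j; rewrite leq0n; apply: apex.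
- move=> i j; rewrite leq_eqVlt => /orP[/eqP->|ik].
    by rewrite ltnn addSn; apply: ring222_adj.
  by rewrite -ltnS ik gring.
- move=> i j; rewrite ltnS leq_eqVlt => /orP[/eqP->|ik] ji.
    (* As r + k is odd, j has the parity of k exactly when j + r is odd, that is, at the vertices of
       [d] with a spoke to [s]. *)
    rewrite eqxx ltnn outer addnS; apply: step222_spoke => //.
    by rewrite oddD ji -oddD addnC.
  by rewrite ik orbT spoke.
- move=> i i' j j'; rewrite [i <= k.+1]leq_eqVlt [i' <= k.+1]leq_eqVlt !ltnS.
  case/orP=> [/eqP->|ik]; case/orP=> [/eqP->|ik']; rewrite ?ltnn.
  + by move/(ringf_inj us)/eqP; rewrite eqn_modDr => /eqP.
  + rewrite ik' => E; case: (sB _ (ringf_mem s (j + r.+1))).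
    by right; exists i', j'.
  + rewrite ik => E; case: (sB _ (ringf_mem s (j' + r.+1))).
    by right; exists i, j.
  + by rewrite ik ik'; apply: inj.
- move=> i j; rewrite leq_eqVlt ltnS => /orP[/eqP->|ik].
    by rewrite ltnn => E; case: (sB _ (ringf_mem s (j + r.+1))); left.
  by rewrite ik; apply: apexN.
case: s d st rs us dB sB closed {outer shift} => [[[[[c0 c1] c2] c3] c4] c5].
case=> [[[[[d0 d1] d2] d3] d4] d5] st _ us dB sB closed x y.
have [[n1 n3 n5] [m0 m2 m4]] := step222_nbrs y st.
set P := layer_vertex _ _ _.
have inP z : layer_vertex k w g z -> P z.
  by move=> lz; apply/layer_vertexS; left.
have inS z : z \in [:: c0; c1; c2; c3; c4; c5] -> P z.
  move=> zs; have [n ->] := @mem_ringf (c0, c1, c2, c3, c4, c5) z zs.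
  apply/layer_vertexS; right; exists (n + 5 * r.+1).
  rewrite -addnA -mulSnr -(ringf_mod _ (n + _)) -modnDmr.
  by rewrite modnMr addn0 ringf_mod.
have old z : layer_vertex k w g z -> P z /\
    [/\ z = c1 -> x \in [:: c0; c2], z = c3 -> x \in [:: c2; c4]
      & z = c5 -> x \in [:: c4; c0]].
  move=> lz; split; first exact: inP.
  by split=> E; case: (sB z) => //; rewrite E !inE eqxx ?orbT.
have new z : z \in [:: c0; c2; c4] -> P z /\
    [/\ z = c1 -> x \in [:: c0; c2], z = c3 -> x \in [:: c2; c4]
      & z = c5 -> x \in [:: c4; c0]].
  move=> zs; split.
    by apply: inS; move: zs; rewrite !inE => /or3P[] ->; rewrite ?orbT.
  by split=> E; move: zs us; rewrite E /= !inE => /or3P[] /eqP E';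
    rewrite E' ?eqxx ?orbT /= ?andbF.
have dy : y \in [:: d0; d2; d4] ++ [:: c0; c2; c4] -> P y /\
    [/\ y = c1 -> x \in [:: c0; c2], y = c3 -> x \in [:: c2; c4]
      & y = c5 -> x \in [:: c4; c0]].
  rewrite mem_cat => /orP[yd|/new//]; apply: old; apply: dB.
  by move: yd; rewrite !inE => /or3P[] ->; rewrite ?orbT.
(* An old vertex is covered by [closed], except d1, d3, d5, whose third neighbour is now on [s]. A
   new one is c0, c2 or c4, with two neighbours on [s] and a spoke back to [d]. *)
move=> /layer_vertexS[lx _ xy|[n Ex] xN xy].
  case: (boolP (x \in [:: d1; d3; d5])) => [|/(closed _ _ lx)/(_ xy)[]/old//].
  case/mem3=> E; rewrite E in xy; apply: dy; rewrite !inE.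
  - by case/mem3: (n1 xy) => ->; rewrite eqxx ?orbT.
  - by case/mem3: (n3 xy) => ->; rewrite eqxx ?orbT.
  - by case/mem3: (n5 xy) => ->; rewrite eqxx ?orbT.
have : x \in [:: c0; c2; c4].
  move: xN (ringf_mem (c0, c1, c2, c3, c4, c5) (n + r.+1)); rewrite -Ex !inE.
  by case: (x == c1); case: (x == c3); case: (x == c5); rewrite ?orbT ?orbF.
have d5L : layer_vertex k w g d5 by apply: dB; rewrite !inE eqxx !orbT.
have d1L : layer_vertex k w g d1 by apply: dB; rewrite !inE eqxx !orbT.
have d3L : layer_vertex k w g d3 by apply: dB; rewrite !inE eqxx !orbT.
case/mem3=> E; rewrite E in xy old *.
- by case/mem3: (m0 xy) => ->; [outer_edge inS us|exact: old|outer_edge inS us].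
- by case/mem3: (m2 xy) => ->; [outer_edge inS us|exact: old|outer_edge inS us].
- by case/mem3: (m4 xy) => ->; [outer_edge inS us|exact: old|outer_edge inS us].
Qed.

(** The path from [s] to a capped ring is read backwards, each of its steps adding one layer. *)
Lemma ring222_layered s : ring222 s ->
  (exists w, cap222 s w) \/ exists k w g r, layered k.+1 s w g r.
Proof.
move=> rs; have [p [w ep cap]] := ring222_cap rs.
have main q x : ring222 x -> path [rel x y | ring222 y && step222 x y] x q ->
    cap222 (last x q) w -> exists g r, layered (size q) x w g r.
  elim: q x => [|y q IH] x rx /=.
    by move=> _ capx; do 2!eexists; apply: layered_cap.
  case/andP=> /andP[ry st] /(IH _ ry) {}IH /IH[g [r ly]].
  by do 2!eexists; apply: layered_step ly.
case: p ep cap => [_ cap|y p ep cap]; [by left; exists w | right].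
by have [g [r ly]] := main (y :: p) s rs ep cap; exists (size p), w, g, r.
Qed.

End Local.

(** Reversing the ring exchanges its sides and the mirror image exchanges them back; the gaps, read
    from c3, become 3, 2, 1. *)
Lemma no_left312 (V : finType) (adj : rel V) (T : V -> V -> V -> bool)
    c0 c1 c2 c3 c4 c5 : cubic46 adj T ->
  T c1 c0 c5 -> T c0 c1 c2 -> T c1 c2 c3 -> T c4 c3 c2 -> T c5 c4 c3 ->
  T c4 c5 c0 -> False.
Proof.
move=> /cubic46_mirror M *.
by apply: (no_left321 M (c0 := c3) (c1 := c2) (c2 := c1) (c3 := c0) (c4 := c5)
  (c5 := c4)).
Qed.

(** * Classification of the patterns of left and right edges *)

Section Patterns.

Variables (V : finType) (adj : rel V) (T : V -> V -> V -> bool).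
Hypothesis M : cubic46 adj T.

Variable K : seq V -> Prop.
Hypothesis K_rot : forall n C, uniq C -> K (rot n C) -> K C.
Hypothesis K_rev : forall C, uniq C -> K (rev C) -> K C.
Hypothesis K_left0 : forall c0 c1 c2 c3 c4 c5,
  uniq [:: c0; c1; c2; c3; c4; c5] ->
  T c5 c0 c1 -> T c0 c1 c2 -> T c1 c2 c3 -> T c2 c3 c4 -> T c3 c4 c5 ->
  T c4 c5 c0 -> K [:: c0; c1; c2; c3; c4; c5].
Hypothesis K_left33 : forall c0 c1 c2 c3 c4 c5,
  uniq [:: c0; c1; c2; c3; c4; c5] ->
  T c1 c0 c5 -> T c0 c1 c2 -> T c1 c2 c3 -> T c4 c3 c2 -> T c3 c4 c5 ->
  T c4 c5 c0 -> K [:: c0; c1; c2; c3; c4; c5].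
Hypothesis K_left222 : forall c0 c1 c2 c3 c4 c5,
  uniq [:: c0; c1; c2; c3; c4; c5] ->
  T c1 c0 c5 -> T c0 c1 c2 -> T c3 c2 c1 -> T c2 c3 c4 -> T c5 c4 c3 ->
  T c4 c5 c0 -> K [:: c0; c1; c2; c3; c4; c5].

Ltac canonical_pattern a b c d e f u := solve
  [ apply (K_left0 u); assumption
  | apply (K_left33 u); assumption
  | apply (K_left222 u); assumption
  | exfalso; apply (no_left1 M u); assumption
  | exfalso; apply (no_left51 M u); assumption
  | exfalso; apply (no_left42 M u); assumption
  | exfalso; apply (no_left411 M u); assumption
  | exfalso; apply (@no_left321 _ _ _ M a b c d e f); assumption
  | exfalso; apply (@no_left312 _ _ _ a b c d e f M); assumption ].

Ltac rotated_pattern n := match goal with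
  u : is_true (uniq ?C) |- K ?C => apply (@K_rot n _ u);
    rewrite -(rot_uniq n) in u; cbv [rot drop take cat] in u |- *;
    match goal with |- K [:: ?a; ?b; ?c; ?d; ?e; ?f] =>
      canonical_pattern a b c d e f u
    end
  end.

Ltac any_rotation := first
  [ rotated_pattern 0 | rotated_pattern 1 | rotated_pattern 2
  | rotated_pattern 3 | rotated_pattern 4 | rotated_pattern 5 ].

(** Up to reversal at most three of the six edges go left, and up to rotation this leaves nine
    patterns: three yield [K] and six are impossible. *)
Lemma ring_patterns c0 c1 c2 c3 c4 c5 : uniq [:: c0; c1; c2; c3; c4; c5] ->
  T c5 c0 c1 \/ T c1 c0 c5 -> T c0 c1 c2 \/ T c2 c1 c0 ->
  T c1 c2 c3 \/ T c3 c2 c1 -> T c2 c3 c4 \/ T c4 c3 c2 ->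
  T c3 c4 c5 \/ T c5 c4 c3 -> T c4 c5 c0 \/ T c0 c5 c4 ->
  K [:: c0; c1; c2; c3; c4; c5].
Proof.
move=> u [h0|h0] [h1|h1] [h2|h2] [h3|h3] [h4|h4] [h5|h5]; first
  [ any_rotation
  | apply: (K_rev u); rewrite -rev_uniq in u; cbv [rev catrev] in u |- *;
    any_rotation ].
Qed.

End Patterns.

Lemma cycle_edges_rot (V : finType) n (C : seq V) :
  uniq C -> cycle_edges (rot n C) = cycle_edges C.
Proof.
move=> u; apply/setP=> e; apply/imsetP/imsetP=> -[x xC ->]; exists x;
  by rewrite ?mem_rot ?next_rot // -(mem_rot n).
Qed.

Lemma cycle_edges_rev (V : finType) (C : seq V) :
  uniq C -> cycle_edges (rev C) = cycle_edges C.
Proof.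
move=> u; apply/setP=> e; apply/imsetP/imsetP=> -[x xC ->].
  exists (prev C x); first by rewrite mem_prev -mem_rev.
  by rewrite next_prev // next_rev // setUC.
exists (next C x); first by rewrite mem_rev mem_next.
by rewrite next_rev // prev_next // setUC.
Qed.

(** * Fullerene graphs as cubic maps *)

Section Fullerene.

Variables (G : plane_graph) (FG : fullerene46 G).

(** The adjacency test is present because [rotation b] is unconstrained off the neighbours of b. *)
Definition turn (a b c : G) := adj b a && (rotation b a == c).

Lemma face_next_inj : injective (face_next (@rotation G)).
Proof. by move=> [a b] [c d] [<-] /perm_inj ->. Qed.

Lemma turn_face_next (a b : G) :
  adj b a -> turn a b (rotation b a).
Proof. by move=> ba; apply/andP. Qed.

(** The orbit of a under [rotation b] is the neighbourhood of b, which has three elements. *)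
Lemma rotation3 (a b : G) : adj b a ->
  [/\ adj b (rotation b a), adj b (rotation b (rotation b a)),
      rotation b (rotation b (rotation b a)) = a,
      uniq [:: a; rotation b a; rotation b (rotation b a)]
    & forall x, adj b x ->
        x \in [:: a; rotation b a; rotation b (rotation b a)]].
Proof.
move=> ba; have E := rotationP ba.
have card : #|porbit (rotation b) a| = 3 by rewrite E; case: FG => ->.
have tr := porbit_traject (rotation b) a; rewrite card /= in tr.
have memE x : adj b x = (x \in [:: a; rotation b a; rotation b (rotation b a)]).
  by rewrite -tr E inE.
split; rewrite ?memE ?inE ?eqxx ?orbT //.
- by have := iter_porbit (rotation b) a; rewrite card.
- by have := uniq_traject_porbit (rotation b) a; rewrite card.
by move=> x; rewrite memE.
Qed.

Lemma face_walkE (a : G * G) n : size (face_walk (@rotation G) a) = n ->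
  face_walk (@rotation G) a =
    [seq b.1 | b <- traject (face_next (@rotation G)) a n] /\
  iter n (face_next (@rotation G)) a = a.
Proof.
rewrite /face_walk size_map size_orbit => <-.
by split=> //; apply: iter_order; apply: face_next_inj.
Qed.

Lemma face_turn (a b : G) : adj a b ->
  (exists c d, [/\ turn a b c, quad turn a b c d
    & face_walk (@rotation G) (a, b) = [:: a; b; c; d]]) \/
  (exists c d e f, [/\ turn a b c, hexa turn a b c d e f
    & face_walk (@rotation G) (a, b) = [:: a; b; c; d; e; f]]).
Proof.
move=> ab; have sym := @adj_sym G; have [_ faceG _] := FG.
have aA : (a, b) \in arcs (@adj G) by rewrite inE.
have nx (x y : G) : adj x y -> adj y (rotation y x).
  by rewrite sym => /rotation3[].
have tn (x y z : G) : adj x y -> rotation y x = z -> turn x y z.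
  by rewrite sym => xy <-; apply: turn_face_next.
case: (faceG _ aA) => -[/andP[_ u] sz]; have [W I] := face_walkE sz;
  [left|right].
  rewrite W /= in u I *; set c := rotation b a in u I *.
  set d := rotation c b in u I *.
  case: I => Ea Eb; rewrite Ea in Eb; exists c, d.
  have bc : adj b c by apply: nx. have cd : adj c d by apply: nx.
  have da : adj d a by rewrite -[X in adj d X]Ea; apply: nx.
  have Q : quad turn a b c d by rewrite /quad !tn.
  by split=> //; case/andP: Q.
rewrite W /= in u I *; set c := rotation b a in u I *.
set d := rotation c b in u I *; set e := rotation d c in u I *.
set f := rotation e d in u I *.
case: I => Ea Eb; rewrite Ea in Eb; exists c, d, e, f.
have bc : adj b c by apply: nx. have cd : adj c d by apply: nx.
have de : adj d e by apply: nx. have ef : adj e f by apply: nx.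
have fa : adj f a by rewrite -[X in adj f X]Ea; apply: nx.
have H : hexa turn a b c d e f by rewrite /hexa !tn.
by split=> //; case/andP: H.
Qed.

Lemma fullerene_cubic46 : cubic46 (@adj G) turn.
Proof.
have sym := @adj_sym G; have [_ _ sq] := FG.
split=> //.
- exact: adj_irr.
- exact: connected.
- by move=> a b c /andP[].
- by move=> a b c /andP[/rotation3[? _ _ _ _] /eqP<-].
- by move=> a b ba; exists (rotation b a); apply: turn_face_next.
- by move=> a b c c' /andP[_ /eqP<-] /andP[_ /eqP].
- move=> a b c /andP[ba /eqP<-]; have [h1 h2 h3 u N] := rotation3 ba.
  exists (rotation b (rotation b a)); split=> //; first exact: turn_face_next.
  by rewrite /turn h2 h3 eqxx.
- move=> a b c abc; have /andP[ba _] := abc; rewrite sym in ba.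
  case: (face_turn ba) => [[c' [d [t Q _]]]|[c' [d [e [f [t H _]]]]]].
    left; exists d; case/andP: abc t => _ /eqP<- /andP[_ /eqP Ec].
    by rewrite Ec.
  right; exists d, e, f; case/andP: abc t => _ /eqP<- /andP[_ /eqP Ec].
  by rewrite Ec.
have : [set F in faces (@adj G) (@rotation G) | #|F| == 4] != set0.
  by rewrite -cards_eq0 sq.
case/set0Pn=> F; rewrite inE => /andP[/imsetP[[a b] ab ->]].
rewrite cardsE => /eqP card4; rewrite inE /= in ab.
have sz : size (face_walk (@rotation G) (a, b)) = 4.
  by rewrite size_map -card4; apply/esym/card_uniqP; apply: orbit_uniq.
case: (face_turn ab) => [[c [d [_ Q _]]]|[c [d [e [f [_ _ W]]]]]].
  by exists a, b, c, d.
by rewrite W in sz.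
Qed.

(** * The four kinds of 6-cycles *)

Definition six_cycle_kind (C : seq G) : Prop :=
  [\/ hexagonal_face_boundary C, dual_square C, square_cap C
    | exists2 k, 1 <= k & layered_square_cap_boundary k C].

Lemma six_cycle_kind_rot n (C : seq G) :
  uniq C -> six_cycle_kind (rot n C) -> six_cycle_kind C.
Proof.
move=> u; have E := cycle_edges_rot n u; case.
- by case=> a aA []; rewrite E; constructor 1; exists a.
- case=> x xC xx; constructor 2; exists x; first by rewrite -(mem_rot n).
  by move: xx; rewrite /= !next_rot.
- case=> w wC [x [y [z [[xC yC zC] [xy yz xz] wxyz]]]]; constructor 3.
  rewrite /nonconsecutive !next_rot // in xy yz xz.
  rewrite !mem_rot in wC xC yC zC.
  by exists w => //; exists x, y, z.
- by case=> k k1 [f []]; rewrite E; constructor 4; exists k => //; exists f.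
Qed.

Lemma six_cycle_kind_rev (C : seq G) :
  uniq C -> six_cycle_kind (rev C) -> six_cycle_kind C.
Proof.
move=> u; have E := cycle_edges_rev u; case.
- by case=> a aA []; rewrite E; constructor 1; exists a.
- case=> x xC; rewrite /= !next_rev // => xx; constructor 2.
  (* Steps in [rev C] go backwards in [C], so the chord is taken from its other end, three steps
     before x. *)
  exists (prev C (prev C (prev C x))); first by rewrite !mem_prev -mem_rev.
  by rewrite /= !next_prev // adj_sym.
- have swap x y : nonconsecutive (rev C) x y -> nonconsecutive C x y.
    rewrite /nonconsecutive !next_rev // => /and3P[-> h1 h2] /=.
    by apply/andP; split; [apply: contraNneq h2 | apply: contraNneq h1] => ->;
      rewrite prev_next.
  case=> w wC [x [y [z [[xC yC zC] [xy yz xz] wxyz]]]]; constructor 3.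
  rewrite !mem_rev in wC xC yC zC.
  by exists w => //; exists x, y, z; split=> //; split; apply: swap.
- by case=> k k1 [f []]; rewrite E; constructor 4; exists k => //; exists f.
Qed.

Lemma next6 (c0 c1 c2 c3 c4 c5 : G) (C := [:: c0; c1; c2; c3; c4; c5]) :
  uniq C -> [/\ [/\ next C c0 = c1, next C c1 = c2 & next C c2 = c3] ,
    next C c3 = c4, next C c4 = c5 & next C c5 = c0].
Proof.
move=> u; have nextE i : i < 6 -> next C (nth c0 C i) = nth c0 C (i.+1 %% 6).
  move=> i6; rewrite next_nth mem_nth // index_uniq //.
  by case: i i6 => [|[|[|[|[|[|]]]]]].
by split; [split|..]; [apply: (nextE 0)|apply: (nextE 1)|apply: (nextE 2)
  |apply: (nextE 3)|apply: (nextE 4)|apply: (nextE 5)].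
Qed.

Let M := fullerene_cubic46.

Lemma layered_boundary k c0 c1 c2 c3 c4 c5 w g r :
  uniq [:: c0; c1; c2; c3; c4; c5] ->
  layered (@adj G) k (c0, c1, c2, c3, c4, c5) w g r ->
  layered_square_cap_boundary k [:: c0; c1; c2; c3; c4; c5].
Proof.
move=> u [_ outer gmod apex gring spoke inj apexN _].
have le (i : 'I_k.+1) : i <= k by rewrite -ltnS.
exists (fun x : cap_vertex k => if x is Some (i, j) then g i j else w); split.
- move=> [[i j]|] [[i' j']|] //=.
  + case/inj=> // /val_inj ->; rewrite !modn_small // => /val_inj -> //.
  + by move/esym/apexN; case.
  + by move/apexN; case.
- have arc x y : cap_arc x y -> adj
      (if x is Some (i, j) then g i j else w)
      (if y is Some (i, j)
       then g (nat_of_ord (i : 'I_k.+1)) (nat_of_ord (j : 'I_6)) else w).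
    case: x y => [[i j]|] [[i' j']|] //=.
      case/orP=> [/andP[/eqP-> /eqP->]|/and3P[/eqP Ei /eqP-> /eqP ij]].
        by rewrite /= gmod //; apply: gring.
      rewrite Ei; apply: spoke; first by rewrite -ltnS -Ei.
      by rewrite !modn2 in ij; move: ij; do 2!case: odd.
    by case/andP=> /eqP-> /apex.
  by move=> x y /orP[/arc//|/arc]; rewrite adj_sym.
(* The outer cycle of [S_k] is mapped to the ring read from index r. *)
rewrite -(cycle_edges_rot (r %% 6) u); congr cycle_edges.
rewrite /cap_outer -map_comp (map_comp (g k) (@nat_of_ord 6)) val_enum_ord /=.
rewrite !outer ![_ + r]addnC -!(ringf_modl _ r).
by elim/mod6_ind: (r %% 6).
Qed.

Lemma left0_kind c0 c1 c2 c3 c4 c5 : uniq [:: c0; c1; c2; c3; c4; c5] ->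
  turn c5 c0 c1 -> turn c0 c1 c2 -> turn c1 c2 c3 -> turn c2 c3 c4 ->
  turn c3 c4 c5 -> turn c4 c5 c0 -> six_cycle_kind [:: c0; c1; c2; c3; c4; c5].
Proof.
move=> u h0 h1 h2 h3 h4 h5.
constructor 1; have a01 : adj c0 c1 by rewrite adj_sym; case/andP: h1.
have H : hexa turn c0 c1 c2 c3 c4 c5 by rewrite /hexa h0 h1 h2 h3 h4 h5.
exists (c0, c1); first by rewrite inE.
case: (face_turn a01) => [[c [d [_ Q _]]]|[c [d [e [f [_ H' W]]]]]].
  by rewrite (negPf (hexa_not_quad M _ _ H)) in Q.
have [<- <- <- <-] := hexa_fun M H H'; rewrite -W; split=> //.
have [_ faceG _] := FG; have aA : (c0, c1) \in arcs (@adj G) by rewrite inE.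
by case: (faceG _ aA) => // -[_]; rewrite W.
Qed.

Lemma left33_kind c0 c1 c2 c3 c4 c5 (C := [:: c0; c1; c2; c3; c4; c5]) :
  uniq C ->
  turn c1 c0 c5 -> turn c0 c1 c2 -> turn c1 c2 c3 -> turn c4 c3 c2 ->
  turn c3 c4 c5 -> turn c4 c5 c0 -> six_cycle_kind C.
Proof.
move=> u h0 h1 h2 h3 h4 h5; have [[nx0 nx1 nx2] _ _ _] := next6 u.
constructor 2; exists c0; first by rewrite inE eqxx.
have -> : iter 3 (next C) c0 = c3.
  exact: etrans (congr1 _ (etrans (congr1 _ nx0) nx1)) nx2.
by apply: left33_chord h0 h1 h2 h3 h4 h5; apply: M.
Qed.

Lemma left222_kind c0 c1 c2 c3 c4 c5 (C := [:: c0; c1; c2; c3; c4; c5]) :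
  uniq C ->
  turn c1 c0 c5 -> turn c0 c1 c2 -> turn c3 c2 c1 -> turn c2 c3 c4 ->
  turn c5 c4 c3 -> turn c4 c5 c0 -> six_cycle_kind C.
Proof.
move=> u h0 h1 h2 h3 h4 h5; have [[nx0 nx1 nx2] nx3 nx4 nx5] := next6 u.
have rs : ring222 turn (c0, c1, c2, c3, c4, c5).
  by rewrite /ring222 h0 h1 h2 h3 h4 h5 !andbT.
case: (ring222_layered M rs) => [[w cap]|[k [w [g [r ly]]]]].
  constructor 3; exists w; first exact: (cap222_apex M cap).
  case/and3P: cap => Q1 Q2 _.
  have nc i j : i < 6 -> j < 6 -> i != j -> nth c0 C i != nth c0 C j.
    by move=> i6 j6; rewrite nth_uniq.
  exists c0, c2, c4; rewrite /nonconsecutive nx0 nx2 nx4 !inE !eqxx ?orbT.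
  have adjr := c46_adjr M; split=> //.
    by split; apply/and3P; split; by [apply: (nc 0 2) | apply: (nc 2 1)
      | apply: (nc 0 3) | apply: (nc 2 4) | apply: (nc 4 3) | apply: (nc 2 5)
      | apply: (nc 0 4) | apply: (nc 4 1) | apply: (nc 0 5)].
  case/quadE: Q1 => _ _ _ w20 _; case/quadE: Q2 => _ _ _ w42 _.
  by split; [exact: adjr w20 | exact: adjr w42
    | exact: adjr (turn_close M w42 w20)].
by constructor 4; exists k.+1 => //; apply: layered_boundary ly.
Qed.

Lemma six_cycle_kindP c0 c1 c2 c3 c4 c5 (C := [:: c0; c1; c2; c3; c4; c5]) :
  ucycle (@adj G) C -> six_cycle_kind C.
Proof.
case/andP=> /andP[a01 /and5P[a12 a23 a34 a45 /andP[a50 _]]] u.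
have nc i j : i < 6 -> j < 6 -> i != j -> nth c0 C i != nth c0 C j.
  by move=> i6 j6; rewrite nth_uniq.
have sides (a b c : G) : adj a b -> adj b c -> a != c ->
    turn a b c \/ turn c b a.
  by rewrite adj_sym; apply: turn_or; apply: M.
apply: (ring_patterns M six_cycle_kind_rot six_cycle_kind_rev left0_kind
  left33_kind left222_kind u); apply: sides => //.
- exact: (nc 5 1).
- exact: (nc 0 2).
- exact: (nc 1 3).
- exact: (nc 2 4).
- exact: (nc 3 5).
- exact: (nc 4 0).
Qed.

End Fullerene.

Theorem theorem2p7 (G : plane_graph) (C : seq G) :
  fullerene46 G -> is_cycle 6 C ->
  [\/ hexagonal_face_boundary C,
      dual_square C,
      square_cap C
    | exists2 k, 1 <= k & layered_square_cap_boundary k C].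
Proof.
move=> FG [cycC].
case: C cycC => [|c0 [|c1 [|c2 [|c3 [|c4 [|c5 [|]]]]]]] // cycC _.
exact: (six_cycle_kindP FG cycC).
Qed.
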